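(* Let $H$ be a coquasi-bialgebra, let $R$ be an associative unital algebra with a weak $H$-action $\cdot: H\otimes R\to R$, and let $\sigma: H\otimes H\to R$ be a linear map. Let $R\overline{\#}_{\sigma}H$ be the vector space $R\otimes H$ (elements written $r\overline{\#}_{\sigma}h$) with the multiplication $$(r\overline{\#}_{\sigma}h)(s\overline{\#}_{\sigma}g)=r(h_1\cdot s)\sigma(h_2,g_1)\overline{\#}_{\sigma}h_3g_2 .$$ Then $R\overline{\#}_{\sigma}H$ is a right $H$-comodule algebra with unit $1_R\overline{\#}_{\sigma}1_H$ and coaction $I_R\otimes\Delta$ if and only if the following relations hold for all $r\in R$ and $h,g,l\in H$: $$1_H\cdot r=r,$$ $$[h_1\cdot(g_1\cdot r)]\sigma(h_2,g_2)=\sigma(h_1,g_1)[(h_2g_2)\cdot r],$$ $$\sigma(h,1_H)=\sigma(1_H,h)=\varepsilon(h)1_R,$$ $$[h_1\cdot\sigma(g_1,l_1)]\sigma(h_2,g_2l_2)=\sigma(h_1,g_1)\sigma(h_2g_2,l_1)\omega^{-1}(h_3,g_3,l_2).$$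
   Context: All vector spaces, algebras and tensor products are over a fixed field $\Bbbk$; Sweedler notation $\Delta(h)=h_1\otimes h_2$ and, for right comodules, $\rho(a)=a_0\otimes a_1$ is used. Coquasi-bialgebra: a coassociative counital coalgebra $(H,\Delta,\varepsilon)$ with coalgebra morphisms $m:H\otimes H\to H$ (written $h\otimes g\mapsto hg$) and $u:\Bbbk\to H$ (with $u(1)=1_H$), and a convolution invertible $\omega\in(H\otimes H\otimes H)^*$ such that for all $h,g,k,l\in H$: $h_1(g_1k_1)\omega(h_2,g_2,k_2)=\omega(h_1,g_1,k_1)(h_2g_2)k_2$; $1_Hh=h1_H=h$; $\omega(h_1,g_1,k_1l_1)\omega(h_2g_2,k_2,l_2)=\omega(g_1,k_1,l_1)\omega(h_1,g_2k_2,l_2)\omega(h_2,g_3,k_3)$; $\omega(h,1_H,g)=\varepsilon(h)\varepsilon(g)$. Here $\omega^{-1}$ is the convolution inverse. Right $H$-comodule algebra: an algebra in the monoidal category of right $H$-comodules, i.e. a right $H$-comodule $(A,\rho_A)$ with an $H$-colinear multiplication $A\otimes A\to A$ (codiagonal coaction, so $\rho_A(ab)=a_0b_0\otimes a_1b_1$) and an $H$-colinear two-sided unit $1_A$ (so $\rho_A(1_A)=1_A\otimes 1_H$), such that $(ab)c=a_0(b_0c_0)\,\omega(a_1,b_1,c_1)$ for all $a,b,c\in A$. Weak action of $H$ on $R$: a bilinear map $h\otimes r\mapsto h\cdot r$ with $h\cdot(rs)=(h_1\cdot r)(h_2\cdot s)$ and $h\cdot 1_R=\varepsilon(h)1_R$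 for all $h\in H$, $r,s\in R$. *)

(* Defs.v *)
From HB Require Import structures.
From mathcomp Require Import all_boot all_order all_algebra.
From mathcomp Require Import boolp.
Set Implicit Arguments.
Unset Strict Implicit.
Unset Printing Implicit Defensive.
Import GRing.Theory.
Local Open Scope ring_scope.
Local Open Scope quotient_scope.

Reserved Notation "u ⊗ v" (at level 40, left associativity).
Reserved Notation "h • g" (at level 40, left associativity).
Reserved Notation "r ∗ s" (at level 40, left associativity).
Reserved Notation "\ts_ ( u , v <- t ) F"
  (at level 36, u name, v name, t at level 200, F at level 36,
   format "\ts_ ( u ,  v  <-  t )  F").
Reserved Notation "\sw_ ( u , v <- c ) F"
  (at level 36, u name, v name, c at level 200, F at level 36,
   format "\sw_ ( u ,  v  <-  c )  F").
Reserved Notation "\sw_ ( u , v , w <- c ) F"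
  (at level 36, u name, v name, w name, c at level 200, F at level 36,
   format "\sw_ ( u ,  v ,  w  <-  c )  F").

(* The list [:: (u_1, v_1); ...; (u_n, v_n)] stands for the formal sum of the
   symbols u_i ⊗ v_i; [tens_eq] is the congruence generated by bilinearity.
   The negative of u ⊗ v is (- u) ⊗ v, so formal sums with signs or scalar
   coefficients are not needed. *)
Inductive tens_eq (k : fieldType) (U V : lmodType k) :
    seq (U * V) -> seq (U * V) -> Prop :=
| TensRefl s : tens_eq s s
| TensSym s t : tens_eq s t -> tens_eq t s
| TensTrans s t r : tens_eq s t -> tens_eq t r -> tens_eq s r
| TensCat s s' t t' : tens_eq s s' -> tens_eq t t' -> tens_eq (s ++ t) (s' ++ t')
| TensCatC s t : tens_eq (s ++ t) (t ++ s)
| Tens0 v : tens_eq [:: (0, v)] [::]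
| TensDl u u' v : tens_eq [:: (u + u', v)] [:: (u, v); (u', v)]
| TensDr u v v' : tens_eq [:: (u, v + v')] [:: (u, v); (u, v')]
| TensZ (a : k) u v : tens_eq [:: (a *: u, v)] [:: (u, a *: v)].

Section Tensor.
Context (k : fieldType) (U V : lmodType k).
Implicit Types (s t : seq (U * V)).

Definition tens_rel : rel (seq (U * V)) := fun s t => `[< tens_eq s t >].

Lemma tens_rel_refl : reflexive tens_rel.
Proof. by move=> s; apply/asboolP; exact: TensRefl. Qed.
Lemma tens_rel_sym : symmetric tens_rel.
Proof. by move=> s t; apply/asboolP/asboolP => /TensSym. Qed.
Lemma tens_rel_trans : transitive tens_rel.
Proof.
by move=> t s r /asboolP st /asboolP tr; apply/asboolP; exact: TensTrans st tr.
Qed.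

Canonical tens_equiv :=
  EquivRel tens_rel tens_rel_refl tens_rel_sym tens_rel_trans.

Definition tensor : Type := {eq_quot tens_equiv}.
HB.instance Definition _ := Choice.on tensor.

Definition tens_pi s : tensor := \pi_{eq_quot tens_equiv} s.
Definition tens_repr (x : tensor) : seq (U * V) :=
  repr (x : {eq_quot tens_equiv}).

Lemma tens_reprK x : tens_pi (tens_repr x) = x.
Proof. exact: reprK. Qed.

Lemma tens_piP s t : tens_pi s = tens_pi t <-> tens_eq s t.
Proof.
split=> [/eqquotP|st]; first by move/asboolP.
by apply/eqquotP/asboolP.
Qed.

Lemma repr_pi s : tens_eq (tens_repr (tens_pi s)) s.
Proof. by apply/tens_piP; rewrite tens_reprK. Qed.

Definition tens (u : U) (v : V) : tensor := tens_pi [:: (u, v)].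

Let mapl (f : U -> U) s := [seq (f p.1, p.2) | p <- s].

Let mapl_eq (f : {linear U -> U}) s t :
  tens_eq s t -> tens_eq (mapl f s) (mapl f t).
Proof.
elim=> {s t} /=.
- by move=> s; exact: TensRefl.
- by move=> s t _; exact: TensSym.
- by move=> s t r _ st _; exact: TensTrans.
- by move=> s s' t t' _ ss _ tt; rewrite /mapl !map_cat; exact: TensCat.
- by move=> s t; rewrite /mapl !map_cat; exact: TensCatC.
- by move=> v; rewrite linear0; exact: Tens0.
- by move=> u u' v; rewrite linearD; exact: TensDl.
- by move=> u v v'; exact: TensDr.
- by move=> a u v; rewrite linearZ; exact: TensZ.
Qed.

Definition tens_add (x y : tensor) := tens_pi (tens_repr x ++ tens_repr y).
Definition tens_opp (x : tensor) :=
  tens_pi [seq (- p.1, p.2) | p <- tens_repr x].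
Definition tens_scale (a : k) (x : tensor) :=
  tens_pi [seq (a *: p.1, p.2) | p <- tens_repr x].

Let addE s t : tens_add (tens_pi s) (tens_pi t) = tens_pi (s ++ t).
Proof. by apply/tens_piP; apply: TensCat; exact: repr_pi. Qed.

Let scaleE a s : tens_scale a (tens_pi s) = tens_pi (mapl ( *:%R a) s).
Proof. by apply/tens_piP; apply: mapl_eq; exact: repr_pi. Qed.

Let piI (P : tensor -> Prop) : (forall s, P (tens_pi s)) -> forall x, P x.
Proof. by move=> Ps x; rewrite -(tens_reprK x). Qed.

Let tens_addA : associative tens_add.
Proof. by elim/piI=> s; elim/piI=> t; elim/piI=> r; rewrite !addE catA. Qed.
Let tens_addC : commutative tens_add.
Proof.
by elim/piI=> s; elim/piI=> t; rewrite !addE; apply/tens_piP; exact: TensCatC.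
Qed.
Let tens_add0 : left_id (tens_pi [::]) tens_add.
Proof. by elim/piI=> s; rewrite addE. Qed.
Let tens_addN : left_inverse (tens_pi [::]) tens_opp tens_add.
Proof.
move=> x; rewrite -{2}(tens_reprK x) addE; apply/tens_piP.
elim: (tens_repr x) => [|[u v] s IHs] /=; first exact: TensRefl.
set s' := map _ s in IHs *.
have -> : (- u, v) :: s' ++ (u, v) :: s =
  [:: (- u, v)] ++ (s' ++ [:: (u, v)]) ++ s by rewrite /= -catA.
apply: (@TensTrans _ _ _ _ ([:: (- u, v)] ++ ([:: (u, v)] ++ s') ++ s)).
  apply: TensCat; first exact: TensRefl.
  by apply: TensCat; [exact: TensCatC|exact: TensRefl].
rewrite -[X in tens_eq X _]/([:: (- u, v); (u, v)] ++ (s' ++ s)).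
rewrite -[X in tens_eq _ X]/([::] ++ [::]); apply: TensCat IHs.
apply: TensTrans (TensSym (TensDl _ _ _)) _.
by rewrite addNr; exact: Tens0.
Qed.

HB.instance Definition _ :=
  GRing.isZmodule.Build tensor tens_addA tens_addC tens_add0 tens_addN.

Lemma tens_pi_cat s t : tens_pi (s ++ t) = tens_pi s + tens_pi t.
Proof. by rewrite [RHS]addE. Qed.
Lemma tens_pi_nil : tens_pi [::] = 0.
Proof. by []. Qed.
Lemma tens_pi_cons p s : tens_pi (p :: s) = tens p.1 p.2 + tens_pi s.
Proof. by case: p => u v; rewrite -cat1s tens_pi_cat. Qed.

Let tens_scaleA a b x : tens_scale a (tens_scale b x) = tens_scale (a * b) x.
Proof.
elim/piI: x => s; rewrite !scaleE /mapl -map_comp; congr tens_pi.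
by apply: eq_map => p /=; rewrite scalerA.
Qed.
Let tens_scale1 : left_id 1 tens_scale.
Proof.
elim/piI=> s; rewrite scaleE /mapl; congr tens_pi.
by rewrite -[RHS]map_id; apply: eq_map => -[u v] /=; rewrite scale1r.
Qed.
Let tens_scaleDr : right_distributive tens_scale +%R.
Proof.
by move=> a; elim/piI=> s; elim/piI=> t; rewrite -tens_pi_cat !scaleE /mapl
  map_cat tens_pi_cat.
Qed.
Let tens_scaleDl x : {morph tens_scale^~ x : a b / a + b}.
Proof.
move=> a b; elim/piI: x => s; rewrite !scaleE.
elim: s => [|[u v] s IHs] /=; first by rewrite !tens_pi_nil addr0.
rewrite !tens_pi_cons /= IHs addrACA; congr (_ + _).
rewrite -tens_pi_cat; apply/tens_piP; rewrite scalerDl; exact: TensDl.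
Qed.

HB.instance Definition _ := GRing.Zmodule_isLmodule.Build k tensor
  tens_scaleA tens_scale1 tens_scaleDr tens_scaleDl.

Lemma tens_linearl v : linear (tens^~ v).
Proof.
move=> a u u'; have -> : a *: tens u v = tens (a *: u) v by rewrite [LHS]scaleE.
by rewrite -tens_pi_cat; apply/tens_piP; exact: TensDl.
Qed.
Lemma tens_linearr u : linear (tens u).
Proof.
move=> a v v'; have -> : a *: tens u v = tens u (a *: v).
  by rewrite [LHS]scaleE; apply/tens_piP; exact: TensZ.
by rewrite -tens_pi_cat; apply/tens_piP; exact: TensDr.
Qed.

End Tensor.

Notation "U ⊗ V" := (tensor U V) : type_scope.
Notation "u ⊗ v" := (tens u v) : ring_scope.

(* For bilinear f, this is the value at x of the linear map on U ⊗ V induced by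
   f; it is meaningful for such f only, being computed on a chosen
   decomposition of x into pure tensors. *)
Definition tsum (k : fieldType) (U V : lmodType k) (W : nmodType)
    (x : U ⊗ V) (f : U -> V -> W) : W :=
  \sum_(p <- tens_repr x) f p.1 p.2.

Notation "\ts_ ( u , v <- x ) F" := (tsum x (fun u v => F)) : ring_scope.

Section TsumTheory.
Context (k : fieldType) (U V : lmodType k).

Let lin0 (X Y : lmodType k) (f : X -> Y) : linear f -> f 0 = 0.
Proof. by move=> lf; have := zmod_morphism_linear lf 0 0; rewrite !subrr. Qed.
Let linZ (X Y : lmodType k) (f : X -> Y) a x : linear f -> f (a *: x) = a *: f x.
Proof. by move=> lf; have := scalable_linear lf a x. Qed.
Let linD (X Y : lmodType k) (f : X -> Y) x y : linear f -> f (x + y) = f x + f y.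
Proof. by move=> lf; rewrite -{1}[x]scale1r lf scale1r. Qed.

Lemma tens_sum (x : U ⊗ V) : \ts_(u, v <- x) (u ⊗ v) = x.
Proof.
rewrite /tsum -[RHS]tens_reprK; elim: (tens_repr x) => [|p s IHs].
  by rewrite big_nil tens_pi_nil.
by rewrite big_cons IHs tens_pi_cons.
Qed.

Lemma tsum_pi (W : lmodType k) (f : U -> V -> W) s :
  bilinear_for *:%R *:%R f ->
  tsum (tens_pi s) f = \sum_(p <- s) f p.1 p.2.
Proof.
move=> [fl fr]; rewrite /tsum.
suff eq_sum t t' : tens_eq t t' ->
    \sum_(p <- t) f p.1 p.2 = \sum_(p <- t') f p.1 p.2.
  exact/eq_sum/repr_pi.
elim=> {s t t'}.
- by [].
- by move=> s t _ ->.
- by move=> s t r _ -> _ ->.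
- by move=> s s' t t' _ ss _ tt; rewrite !big_cat ss tt.
- by move=> s t; rewrite !big_cat /= addrC.
- by move=> v; rewrite big_seq1 big_nil /= (lin0 (fl v)).
- by move=> u u' v; rewrite big_seq1 big_cons big_seq1 /= (linD _ _ (fl v)).
- by move=> u v v'; rewrite big_seq1 big_cons big_seq1 /= (linD _ _ (fr u)).
- by move=> a u v; rewrite !big_seq1 /= (linZ _ _ (fl v)) (linZ _ _ (fr u)).
Qed.

Lemma tsum_tens (W : lmodType k) (f : U -> V -> W) u v :
  bilinear_for *:%R *:%R f -> tsum (u ⊗ v) f = f u v.
Proof. by move=> bf; rewrite tsum_pi // big_seq1. Qed.

Lemma linear_tsum (W X : lmodType k) (g : X -> U ⊗ V) (f : U -> V -> W) :
  linear g -> (forall v, linear (f^~ v)) -> (forall u, linear (f u)) ->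
  linear (fun x => tsum (g x) f).
Proof.
move=> lg fl fr a x y; rewrite lg.
have bf : bilinear_for *:%R *:%R f by split.
have tsumD s t : tsum (tens_pi s + tens_pi t) f =
    tsum (tens_pi s) f + tsum (tens_pi t) f.
  by rewrite -tens_pi_cat !tsum_pi // big_cat.
rewrite -(tens_reprK (a *: g x)) -(tens_reprK (g y)) tsumD !tens_reprK.
congr (_ + _); rewrite -{1}(tens_reprK (g x)) /tsum.
elim: (tens_repr (g x)) => [|p s IHs].
  by rewrite tens_pi_nil !scaler0 -tens_pi_nil [LHS]tsum_pi // !big_nil scaler0.
have -> : a *: tens_pi (p :: s) = tens_pi [:: (a *: p.1, p.2)] + a *: tens_pi s.
  by rewrite tens_pi_cons scalerDr -(linZ _ _ (@tens_linearl _ _ _ p.2)).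
rewrite -(tens_reprK (a *: tens_pi s)) [LHS]tsumD tens_reprK.
rewrite [X in _ + X]IHs tsum_tens //.
rewrite big_cons scalerDr; congr (_ + _).
by rewrite (linZ _ _ (fl p.2)).
Qed.

Lemma linear_tsumr (W X : lmodType k) (x : U ⊗ V) (f : X -> U -> V -> W) :
  (forall u v, linear (fun y => f y u v)) -> linear (fun y => tsum x (f y)).
Proof.
move=> lf a y z; rewrite /tsum scaler_sumr -big_split.
by apply: eq_bigr => p _; rewrite lf.
Qed.

End TsumTheory.

Record coalgebra (k : fieldType) := Coalgebra {
  coalg_space :> lmodType k;
  comul : {linear coalg_space -> (coalg_space ⊗ coalg_space)%type};
  counit : {scalar coalg_space};
  comulA : forall c, \ts_(c1, c2 <- comul c) \ts_(c11, c12 <- comul c1)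
                       (c11 ⊗ c12 ⊗ c2) =
                     \ts_(c1, c2 <- comul c) \ts_(c21, c22 <- comul c2)
                       (c1 ⊗ c21 ⊗ c22);
  comul_counitl : forall c, \ts_(c1, c2 <- comul c) (counit c1 *: c2) = c;
  comul_counitr : forall c, \ts_(c1, c2 <- comul c) (counit c2 *: c1) = c
}.

Definition sweedler2 (k : fieldType) (C : coalgebra k) (W : nmodType)
    (c : C) (f : C -> C -> W) : W :=
  tsum (comul C c) f.

Definition sweedler3 (k : fieldType) (C : coalgebra k) (W : nmodType)
    (c : C) (f : C -> C -> C -> W) : W :=
  \ts_(c1, c' <- comul C c) \ts_(c2, c3 <- comul C c') f c1 c2 c3.

Notation "\sw_ ( u , v <- c ) F" :=
  (sweedler2 c (fun u v => F)) : ring_scope.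
Notation "\sw_ ( u , v , w <- c ) F" :=
  (sweedler3 c (fun u v w => F)) : ring_scope.

(* The coalgebra map u is encoded by the element 1_H = u(1), and the elements
   of (H ⊗ H ⊗ H)^* are scalar linear maps; the convolution inverse is part of
   the data, being unique. *)
Record coquasiBialgebra (k : fieldType) := CoquasiBialgebra {
  cqb_coalg :> coalgebra k;
  cqb_mul : {linear (cqb_coalg ⊗ cqb_coalg)%type -> cqb_coalg}
    where "h • g" := (cqb_mul (h ⊗ g));
  cqb_one : cqb_coalg;
  cqb_omega : {scalar (cqb_coalg ⊗ cqb_coalg ⊗ cqb_coalg)%type};
  cqb_omegaV : {scalar (cqb_coalg ⊗ cqb_coalg ⊗ cqb_coalg)%type};
  comul_mul : forall h g,
    comul cqb_coalg (h • g) =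
    \sw_(h1, h2 <- h) \sw_(g1, g2 <- g) ((h1 • g1) ⊗ (h2 • g2));
  counit_mul : forall h g,
    counit cqb_coalg (h • g) = counit cqb_coalg h * counit cqb_coalg g;
  comul_one : comul cqb_coalg cqb_one = cqb_one ⊗ cqb_one;
  counit_one : counit cqb_coalg cqb_one = 1;
  omegaK : forall h g l,
    \sw_(h1, h2 <- h) \sw_(g1, g2 <- g) \sw_(l1, l2 <- l)
      (cqb_omega (h1 ⊗ g1 ⊗ l1) * cqb_omegaV (h2 ⊗ g2 ⊗ l2)) =
    counit cqb_coalg h * counit cqb_coalg g * counit cqb_coalg l;
  omegaVK : forall h g l,
    \sw_(h1, h2 <- h) \sw_(g1, g2 <- g) \sw_(l1, l2 <- l)
      (cqb_omegaV (h1 ⊗ g1 ⊗ l1) * cqb_omega (h2 ⊗ g2 ⊗ l2)) =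
    counit cqb_coalg h * counit cqb_coalg g * counit cqb_coalg l;
  cqb_mulA : forall h g l,
    \sw_(h1, h2 <- h) \sw_(g1, g2 <- g) \sw_(l1, l2 <- l)
      (cqb_omega (h2 ⊗ g2 ⊗ l2) *: (h1 • (g1 • l1))) =
    \sw_(h1, h2 <- h) \sw_(g1, g2 <- g) \sw_(l1, l2 <- l)
      (cqb_omega (h1 ⊗ g1 ⊗ l1) *: ((h2 • g2) • l2));
  cqb_mul1l : forall h, cqb_one • h = h;
  cqb_mul1r : forall h, h • cqb_one = h;
  omega_cocycle : forall h g l m,
    \sw_(h1, h2 <- h) \sw_(g1, g2 <- g) \sw_(l1, l2 <- l) \sw_(m1, m2 <- m)
      (cqb_omega (h1 ⊗ g1 ⊗ (l1 • m1)) * cqb_omega ((h2 • g2) ⊗ l2 ⊗ m2)) =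
    \sw_(h1, h2 <- h) \sw_(g1, g2, g3 <- g) \sw_(l1, l2, l3 <- l)
    \sw_(m1, m2 <- m)
      (cqb_omega (g1 ⊗ l1 ⊗ m1) * cqb_omega (h1 ⊗ (g2 • l2) ⊗ m2) *
       cqb_omega (h2 ⊗ g3 ⊗ l3));
  omega_normal : forall h g,
    cqb_omega (h ⊗ cqb_one ⊗ g) = counit cqb_coalg h * counit cqb_coalg g
}.

Notation "h • g" := (cqb_mul _ (h ⊗ g)) : ring_scope.

Record right_comodule (k : fieldType) (C : coalgebra k) (A : lmodType k)
    (rho : {linear A -> (A ⊗ C)%type}) : Prop := RightComodule {
  coactA : forall a,
    \ts_(a0, a1 <- rho a) \ts_(a00, a01 <- rho a0) (a00 ⊗ a01 ⊗ a1) =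
    \ts_(a0, a1 <- rho a) \sw_(a11, a12 <- a1) (a0 ⊗ a11 ⊗ a12);
  coact_counit : forall a, \ts_(a0, a1 <- rho a) (counit C a1 *: a0) = a
}.

Record comodule_algebra (k : fieldType) (H : coquasiBialgebra k)
    (A : lmodType k) (rho : {linear A -> (A ⊗ H)%type}) (mul : {linear (A ⊗ A)%type -> A})
    (one : A) : Prop := ComoduleAlgebra {
  comodalg_comod : right_comodule rho;
  comodalg_coact_mul : forall a b,
    rho (mul (a ⊗ b)) =
    \ts_(a0, a1 <- rho a) \ts_(b0, b1 <- rho b) (mul (a0 ⊗ b0) ⊗ (a1 • b1));
  comodalg_coact_one : rho one = one ⊗ cqb_one H;
  comodalg_mul1l : forall a, mul (one ⊗ a) = a;
  comodalg_mul1r : forall a, mul (a ⊗ one) = a;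
  comodalg_mulA : forall a b c,
    mul (mul (a ⊗ b) ⊗ c) =
    \ts_(a0, a1 <- rho a) \ts_(b0, b1 <- rho b) \ts_(c0, c1 <- rho c)
      (cqb_omega H (a1 ⊗ b1 ⊗ c1) *: mul (a0 ⊗ mul (b0 ⊗ c0)))
}.

(* Unlike algType, this allows the zero algebra. *)
Record assocAlgebra (k : fieldType) := AssocAlgebra {
  alg_space :> lmodType k;
  alg_mul : {linear (alg_space ⊗ alg_space)%type -> alg_space}
    where "r ∗ s" := (alg_mul (r ⊗ s));
  alg_one : alg_space;
  alg_mulA : forall r s t, r ∗ (s ∗ t) = (r ∗ s) ∗ t;
  alg_mul1l : forall r, alg_one ∗ r = r;
  alg_mul1r : forall r, r ∗ alg_one = r
}.

Notation "r ∗ s" := (alg_mul _ (r ⊗ s)) : ring_scope.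

Record weak_action (k : fieldType) (H : coquasiBialgebra k)
    (R : assocAlgebra k) (act : {linear (H ⊗ R)%type -> R}) : Prop := WeakAction {
  weak_act_mul : forall h r s,
    act (h ⊗ (r ∗ s)) = \sw_(h1, h2 <- h) (act (h1 ⊗ r) ∗ act (h2 ⊗ s));
  weak_act_one : forall h, act (h ⊗ alg_one R) = counit H h *: alg_one R
}.

Section CrossedProduct.
Context (k : fieldType) (H : coquasiBialgebra k) (R : assocAlgebra k).
Context (act : {linear (H ⊗ R)%type -> R}) (sigma : {linear (H ⊗ H)%type -> R}).

Let mul_fun (x y : R ⊗ H) : R ⊗ H :=
  \ts_(r, h <- x) \ts_(s, g <- y) \sw_(h1, h2, h3 <- h) \sw_(g1, g2 <- g)
    ((r ∗ act (h1 ⊗ s) ∗ sigma (h2 ⊗ g1)) ⊗ (h3 • g2)).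

Ltac lin_leaf := let a := fresh in let x := fresh in let y := fresh in
  move=> a x y /=; rewrite ?(linearP, tens_linearl, tens_linearr) //.
Ltac lin := repeat match goal with
  | |- forall _, _ => intro
  | |- _ => apply: linear_tsumr
  | |- _ => apply: linear_tsum
  | |- _ => by lin_leaf
  end.

Lemma crossed_mul_bilinear : bilinear_for *:%R *:%R mul_fun.
Proof. by rewrite /mul_fun /sweedler3 /sweedler2; split; lin. Qed.

(* [crossed_mulE] gives the value on pure tensors. *)
Definition crossed_mul (z : (R ⊗ H ⊗ (R ⊗ H))%type) : R ⊗ H := tsum z mul_fun.

Lemma crossed_mul_linear : linear crossed_mul.
Proof.
by have [ml mr] := crossed_mul_bilinear; exact: linear_tsum ml mr.
Qed.
HB.instance Definition _ := GRing.isLinear.Build k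
  (R ⊗ H ⊗ (R ⊗ H))%type (R ⊗ H)%type *:%R crossed_mul crossed_mul_linear.

Lemma crossed_mulE r h s g :
  crossed_mul ((r ⊗ h) ⊗ (s ⊗ g)) =
  \sw_(h1, h2, h3 <- h) \sw_(g1, g2 <- g)
    ((r ∗ act (h1 ⊗ s) ∗ sigma (h2 ⊗ g1)) ⊗ (h3 • g2)).
Proof.
rewrite /crossed_mul tsum_tens; last exact: crossed_mul_bilinear.
rewrite /mul_fun /sweedler3 /sweedler2.
by rewrite tsum_tens; first rewrite tsum_tens //; split; lin.
Qed.

(* I_R ⊗ Δ, with R ⊗ (H ⊗ H) identified with (R ⊗ H) ⊗ H. *)
Definition crossed_coact (x : R ⊗ H) : (R ⊗ H ⊗ H)%type :=
  \ts_(r, h <- x) \sw_(h1, h2 <- h) (r ⊗ h1 ⊗ h2).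

Lemma crossed_coact_linear : linear crossed_coact.
Proof. by rewrite /crossed_coact /sweedler2; lin. Qed.
HB.instance Definition _ := GRing.isLinear.Build k
  (R ⊗ H)%type (R ⊗ H ⊗ H)%type *:%R crossed_coact crossed_coact_linear.

End CrossedProduct.

Arguments crossed_coact [k] H R x.

(* Main.v *)
Require Import Defs.
From HB Require Import structures.
From mathcomp Require Import all_boot all_order all_algebra.
Set Implicit Arguments.
Unset Strict Implicit.
Unset Printing Implicit Defensive.
Import GRing.Theory.
Local Open Scope ring_scope.

(** Write u_h for the element 1 # h of R # H, and let R act on R # H from the
    left by multiplication in the first factor, so that r # h = r ▷ u_h. The
    product is left R-linear, and the weak action gives two commutation rules

      u_h u_g = σ(h_1, g_1) ▷ u_{h_2 g_2},
      u_h (t ▷ x) = (h_1 · t) ▷ (u_{h_2} x),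

    in the second of which x is arbitrary ([mul_uu], [mul_u_lact]). The
    coaction always is a comodule structure for which the product is colinear,
    so what remains is the unit and the twisted associativity ([crossed_algebraP]).
    On pure tensors the latter says

      ((r # h) (s # g)) (t # l) = ω(h_2, g_2, l_2) (r # h_1) ((s # g_1) (t # l_1)),

    whose right-hand side is denoted below by [twist ω] of the function
    (h, g, l) |-> (r # h) ((s # g) (t # l)).

    Sufficiency. By the second rule, r and s can be moved out of both sides as
    the same factor r (h_1 · s), and coassociativity carries this factor through
    ω; hence one may take r = s = 1 ([assoc_rst]). The element t leaves the
    right-hand side as the factor h_1 · (g_1 · t), and the left-hand side as
    σ(h_1, g_1) ((h_2 g_2) · t); the twisted module condition moves the
    latter past σ, so that one may take t = 1 as well ([assoc_uut]). Finally

      (u_h u_g) u_l = Y(h_1, g_1, l_1) ▷ u_{(h_2 g_2) l_2},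
      u_h (u_g u_l) = X(h_1, g_1, l_1) ▷ u_{h_2 (g_2 l_2)},

    where X(h, g, l) = [h_1 · σ(g_1, l_1)] σ(h_2, g_2 l_2) is [coef_right] and
    Y(h, g, l) = σ(h_1, g_1) σ(h_2 g_2, l) is [coef_left]. As ω also controls the
    associativity of H, the case r = s = t = 1 follows from Y = X * ω
    ([assoc_uuu]), which is the cocycle condition X = Y * ω^{-1} because ω is
    convolution invertible ([cocycleP]).

    Necessity. Each condition is the image of an instance of the axioms under
    I ⊗ ε : R ⊗ H -> R, which maps u_h u_g to σ(h, g): the unit axioms give
    the normalizations, the associativity of u_h, u_g, u_l gives Y = X * ω,
    and that of u_h, u_g, t # 1_H gives the twisted module condition
    ([assoc_twisted_module]). *)

(** * Multilinear maps on tensor products *)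

Section Linearity.
Context (k : fieldType).
Implicit Types (U V W X : lmodType k).

Lemma linear_tensl U V X (f : X -> U) (v : V) :
  linear f -> linear (fun x => f x ⊗ v).
Proof. by move=> lf a x y; rewrite lf tens_linearl. Qed.

Lemma linear_tensr U V X (f : X -> V) (u : U) :
  linear f -> linear (fun x => u ⊗ f x).
Proof. by move=> lf a x y; rewrite lf tens_linearr. Qed.

Lemma linear_comp U V X (g : {linear U -> V}) (f : X -> U) :
  linear f -> linear (fun x => g (f x)).
Proof. by move=> lf a x y; rewrite lf linearP. Qed.

Lemma linear_scaler W X (f : X -> W) (b : k) :
  linear f -> linear (fun x => b *: f x).
Proof. by move=> lf a x y; rewrite lf scalerDr !scalerA mulrC. Qed.

Lemma linear_scalel U W X (g : {scalar U}) (f : X -> U) (w : W) :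
  linear f -> linear (fun x => g (f x) *: w).
Proof. by move=> lf a x y; rewrite lf linearP scalerDl scalerA. Qed.

End Linearity.

(** Decides linearity in one variable of expressions built from tensors, linear
    maps, scalings and Sweedler sums, using the hypotheses for abstract maps. *)
Ltac lin :=
  rewrite /sweedler3 /sweedler2;
  repeat match goal with
  | |- bilinear_for _ _ _ => split
  | |- forall _, _ => intro
  | |- _ => done
  | |- _ => solve [auto]
  | |- _ => first [ apply: linear_tsumr | apply: linear_tsum
    | apply: linear_tensl | apply: linear_tensr
    | apply: linear_scaler | apply: linear_scalel | apply: linear_comp ]
  end.

Section LinearMaps.
Context (k : fieldType).
Implicit Types (U V W X : lmodType k).

Lemma linear_fun0 V W (f : V -> W) : linear f -> f 0 = 0.
Proof. by move=> lf; have := lf (-1) 0 0; rewrite !scaleN1r !addNr. Qed.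

Lemma linear_funD V W (f : V -> W) : linear f -> {morph f : x y / x + y}.
Proof. by move=> lf x y; rewrite -[x]scale1r lf !scale1r. Qed.

Lemma linear_funZ V W (f : V -> W) a x : linear f -> f (a *: x) = a *: f x.
Proof. by move=> lf; have := lf a x 0; rewrite (linear_fun0 lf) !addr0. Qed.

Lemma tens_ext U V W (f g : (U ⊗ V)%type -> W) :
  linear f -> linear g -> (forall u v, f (u ⊗ v) = g (u ⊗ v)) -> f =1 g.
Proof.
move=> lf lg fg x; rewrite -(tens_reprK x).
elim: (tens_repr x) => [|p s IHs]; first by rewrite tens_pi_nil !linear_fun0.
by rewrite tens_pi_cons !linear_funD // fg IHs.
Qed.

Lemma fun_tsum U V W X (f : W -> X) (x : (U ⊗ V)%type) (F : U -> V -> W) :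
  linear f -> f (\ts_(u, v <- x) F u v) = \ts_(u, v <- x) f (F u v).
Proof. by move=> lf; apply: (big_morph f (linear_funD lf) (linear_fun0 lf)). Qed.

Lemma eq_tsum U V W (x : (U ⊗ V)%type) (F G : U -> V -> W) :
  (forall a b, F a b = G a b) -> \ts_(a, b <- x) F a b = \ts_(a, b <- x) G a b.
Proof. by move=> FG; apply: eq_bigr => p _; apply: FG. Qed.

End LinearMaps.

(** * Sweedler sums *)

Section Sweedler.
Context (k : fieldType) (C : coalgebra k).
Implicit Types (W V U : lmodType k) (c : C).

Lemma eq_sw W c (F G : C -> C -> W) :
  (forall a b, F a b = G a b) -> \sw_(a, b <- c) F a b = \sw_(a, b <- c) G a b.
Proof. exact: eq_tsum. Qed.

Lemma sw_exchange (D : coalgebra k) W c (d : D) (F : C -> C -> D -> D -> W) :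
  \sw_(c1, c2 <- c) \sw_(d1, d2 <- d) F c1 c2 d1 d2 =
  \sw_(d1, d2 <- d) \sw_(c1, c2 <- c) F c1 c2 d1 d2.
Proof. exact: exchange_big. Qed.

Lemma fun_sw W V (f : V -> W) c (F : C -> C -> V) :
  linear f -> f (\sw_(a, b <- c) F a b) = \sw_(a, b <- c) f (F a b).
Proof. exact: fun_tsum. Qed.

Lemma linear_sw W V (f : {linear V -> W}) c (F : C -> C -> V) :
  f (\sw_(a, b <- c) F a b) = \sw_(a, b <- c) f (F a b).
Proof. exact: linear_sum. Qed.

Lemma tens_swl U V c (F : C -> C -> U) (v : V) :
  (\sw_(a, b <- c) F a b) ⊗ v = \sw_(a, b <- c) (F a b ⊗ v).
Proof. exact: (fun_sw c F (tens_linearl v)). Qed.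

Lemma tens_swr U V c (F : C -> C -> V) (u : U) :
  u ⊗ (\sw_(a, b <- c) F a b) = \sw_(a, b <- c) (u ⊗ F a b).
Proof. exact: (fun_sw c F (tens_linearr u)). Qed.

Lemma scale_sw W c (F : C -> C -> W) (a : k) :
  a *: (\sw_(x, y <- c) F x y) = \sw_(x, y <- c) (a *: F x y).
Proof. exact: scaler_sumr. Qed.

Lemma sw_scale W c (F : C -> C -> k) (w : W) :
  (\sw_(x, y <- c) F x y) *: w = \sw_(x, y <- c) (F x y *: w).
Proof. exact: scaler_suml. Qed.

(** This is the image of the coassociativity axiom under the linear map on
    C ⊗ C ⊗ C induced by F. *)
Lemma sw_coassoc W (F : C -> C -> C -> W) c :
  (forall y z, linear (fun x => F x y z)) ->
  (forall x z, linear (fun y => F x y z)) ->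
  (forall x y, linear (fun z => F x y z)) ->
  \sw_(a, b <- c) \sw_(x, y <- a) F x y b =
  \sw_(a, b <- c) \sw_(x, y <- b) F a x y.
Proof.
move=> l1 l2 l3.
pose g (t : (C ⊗ C ⊗ C)%type) := \ts_(s, z <- t) \ts_(x, y <- s) F x y z.
have lg : linear g by rewrite /g; lin.
have gE x y z : g (x ⊗ y ⊗ z) = F x y z.
  by rewrite /g tsum_tens ?tsum_tens //; lin.
have := congr1 g (comulA c); rewrite !(fun_tsum _ _ lg).
rewrite !(eq_tsum _ (fun a b => fun_tsum _ _ lg)).
by rewrite !(eq_tsum _ (fun a b => eq_tsum _ (fun x y => gE _ _ _))).
Qed.

Lemma sw_counitl W c (F : C -> W) :
  linear F -> \sw_(a, b <- c) (counit C a *: F b) = F c.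
Proof.
move=> lF; rewrite -[in RHS](comul_counitl c) (fun_tsum _ _ lF).
by apply: eq_tsum => a b; rewrite linear_funZ.
Qed.

Lemma sw_counitr W c (F : C -> W) :
  linear F -> \sw_(a, b <- c) (counit C b *: F a) = F c.
Proof.
move=> lF; rewrite -[in RHS](comul_counitr c) (fun_tsum _ _ lF).
by apply: eq_tsum => a b; rewrite linear_funZ.
Qed.

(** Coassociativity in two variables at once: after exchanging the inner sums,
    it is [sw_coassoc] for each variable. *)
Lemma sw_coassoc2 W (F : C -> C -> C -> C -> C -> C -> W) c d :
  (forall x2 x3 y1 y2 y3, linear (fun x1 => F x1 x2 x3 y1 y2 y3)) ->
  (forall x1 x3 y1 y2 y3, linear (fun x2 => F x1 x2 x3 y1 y2 y3)) ->
  (forall x1 x2 y1 y2 y3, linear (fun x3 => F x1 x2 x3 y1 y2 y3)) ->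
  (forall x1 x2 x3 y2 y3, linear (fun y1 => F x1 x2 x3 y1 y2 y3)) ->
  (forall x1 x2 x3 y1 y3, linear (fun y2 => F x1 x2 x3 y1 y2 y3)) ->
  (forall x1 x2 x3 y1 y2, linear (fun y3 => F x1 x2 x3 y1 y2 y3)) ->
  \sw_(c1, c2 <- c) \sw_(d1, d2 <- d) \sw_(x1, x2 <- c1) \sw_(y1, y2 <- d1)
    F x1 x2 c2 y1 y2 d2 =
  \sw_(c1, c2 <- c) \sw_(d1, d2 <- d) \sw_(x2, x3 <- c2) \sw_(y2, y3 <- d2)
    F c1 x2 x3 d1 y2 y3.
Proof.
move=> *.
under eq_sw => c1 c2 do rewrite sw_exchange.
under [RHS]eq_sw => c1 c2 do rewrite sw_exchange.
rewrite sw_coassoc; try by lin.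
apply: eq_sw => c1 c2; apply: eq_sw => x2 x3.
by rewrite sw_coassoc.
Qed.

(** Coassociativity of the coalgebra C ⊗ C ⊗ C, with its maps written as
    functions of three variables. *)
Lemma sw_coassoc3 W (F : C -> C -> C -> C -> C -> C -> C -> C -> C -> W) c d e :
  (forall x2 x3 y1 y2 y3 z1 z2 z3, linear (fun x1 => F x1 x2 x3 y1 y2 y3 z1 z2 z3)) ->
  (forall x1 x3 y1 y2 y3 z1 z2 z3, linear (fun x2 => F x1 x2 x3 y1 y2 y3 z1 z2 z3)) ->
  (forall x1 x2 y1 y2 y3 z1 z2 z3, linear (fun x3 => F x1 x2 x3 y1 y2 y3 z1 z2 z3)) ->
  (forall x1 x2 x3 y2 y3 z1 z2 z3, linear (fun y1 => F x1 x2 x3 y1 y2 y3 z1 z2 z3)) ->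
  (forall x1 x2 x3 y1 y3 z1 z2 z3, linear (fun y2 => F x1 x2 x3 y1 y2 y3 z1 z2 z3)) ->
  (forall x1 x2 x3 y1 y2 z1 z2 z3, linear (fun y3 => F x1 x2 x3 y1 y2 y3 z1 z2 z3)) ->
  (forall x1 x2 x3 y1 y2 y3 z2 z3, linear (fun z1 => F x1 x2 x3 y1 y2 y3 z1 z2 z3)) ->
  (forall x1 x2 x3 y1 y2 y3 z1 z3, linear (fun z2 => F x1 x2 x3 y1 y2 y3 z1 z2 z3)) ->
  (forall x1 x2 x3 y1 y2 y3 z1 z2, linear (fun z3 => F x1 x2 x3 y1 y2 y3 z1 z2 z3)) ->
  \sw_(c1, c2 <- c) \sw_(d1, d2 <- d) \sw_(e1, e2 <- e)
  \sw_(x1, x2 <- c1) \sw_(y1, y2 <- d1) \sw_(z1, z2 <- e1)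
    F x1 x2 c2 y1 y2 d2 z1 z2 e2 =
  \sw_(c1, c2 <- c) \sw_(d1, d2 <- d) \sw_(e1, e2 <- e)
  \sw_(x2, x3 <- c2) \sw_(y2, y3 <- d2) \sw_(z2, z3 <- e2)
    F c1 x2 x3 d1 y2 y3 e1 z2 z3.
Proof.
move=> *.
under eq_sw => c1 c2.
  under eq_sw => d1 d2.
    rewrite sw_exchange.
    under eq_sw => x1 x2 do rewrite sw_exchange.
    over.
  over.
under [RHS]eq_sw => c1 c2.
  under eq_sw => d1 d2.
    rewrite sw_exchange.
    under eq_sw => x1 x2 do rewrite sw_exchange.
    over.
  over.
rewrite sw_coassoc2; try by lin.
do 4 (apply: eq_sw => ? ?).
by rewrite sw_coassoc.
Qed.
End Sweedler.

(** * Convolution with scalar forms on a coquasi-bialgebra *)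

Section CoquasiBialgebra.
Context (k : fieldType) (H : coquasiBialgebra k).

Lemma sw_mul (W : lmodType k) (h g : H) (F : H -> H -> W) :
  (forall v, linear (F^~ v)) -> (forall u, linear (F u)) ->
  \sw_(x1, x2 <- h • g) F x1 x2 =
  \sw_(h1, h2 <- h) \sw_(g1, g2 <- g) F (h1 • g1) (h2 • g2).
Proof.
move=> Fl Fr; rewrite {1}/sweedler2 comul_mul.
have lF : linear (fun t : (H ⊗ H)%type => tsum t F) by lin.
rewrite (fun_sw _ _ lF); apply: eq_sw => h1 h2.
by rewrite (fun_sw _ _ lF); apply: eq_sw => g1 g2; rewrite tsum_tens.
Qed.

Lemma sw_one (W : lmodType k) (F : H -> H -> W) :
  (forall v, linear (F^~ v)) -> (forall u, linear (F u)) ->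
  \sw_(a, b <- cqb_one H) F a b = F (cqb_one H) (cqb_one H).
Proof. by move=> Fl Fr; rewrite /sweedler2 comul_one tsum_tens. Qed.

(** The convolution product F * phi, where phi acts by scalars. *)
Definition twist (phi : {scalar (H ⊗ H ⊗ H)%type}) (W : lmodType k)
    (F : H -> H -> H -> W) h g l :=
  \sw_(h1, h2 <- h) \sw_(g1, g2 <- g) \sw_(l1, l2 <- l)
    (phi (h2 ⊗ g2 ⊗ l2) *: F h1 g1 l1).

Lemma eq_twist phi (W : lmodType k) (F G : H -> H -> H -> W) h g l :
  (forall x y z, F x y z = G x y z) -> twist phi F h g l = twist phi G h g l.
Proof. by move=> FG; do 3 apply: eq_sw => ? ?; rewrite FG. Qed.

(** Convolution is associative: (F * phi) * psi = F * (phi * psi). *)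
Lemma twistK (phi psi : {scalar (H ⊗ H ⊗ H)%type}) (W : lmodType k)
    (F : H -> H -> H -> W) :
  (forall h g l,
    \sw_(h1, h2 <- h) \sw_(g1, g2 <- g) \sw_(l1, l2 <- l)
      (phi (h1 ⊗ g1 ⊗ l1) * psi (h2 ⊗ g2 ⊗ l2)) =
    counit H h * counit H g * counit H l) ->
  (forall g l, linear (fun h => F h g l)) ->
  (forall h l, linear (fun g => F h g l)) ->
  (forall h g, linear (fun l => F h g l)) ->
  forall h g l, twist psi (twist phi F) h g l = F h g l.
Proof.
move=> phiK F1 F2 F3 h g l.
transitivity (\sw_(h1, h2 <- h) \sw_(g1, g2 <- g) \sw_(l1, l2 <- l)
   \sw_(a, b <- h1) \sw_(c, d <- g1) \sw_(e, f <- l1)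
     (psi (h2 ⊗ g2 ⊗ l2) *: (phi (b ⊗ d ⊗ f) *: F a c e))).
  do 3 apply: eq_sw => ? ?.
  by do 3 (rewrite scale_sw; apply: eq_sw => ? ?).
rewrite sw_coassoc3; try by lin.
transitivity (\sw_(h1, h2 <- h) \sw_(g1, g2 <- g) \sw_(l1, l2 <- l)
    ((counit H h2 * counit H g2 * counit H l2) *: F h1 g1 l1)).
  do 3 apply: eq_sw => ? ?.
  rewrite -phiK; do 3 (rewrite sw_scale; apply: eq_sw => ? ?).
  by rewrite scalerA mulrC.
rewrite -[RHS](sw_counitr h (F1 g l)); apply: eq_sw => h1 h2.
rewrite -(sw_counitr g (F2 h1 l)) scale_sw; apply: eq_sw => g1 g2.
rewrite -(sw_counitr l (F3 h1 g1)) !scale_sw; apply: eq_sw => l1 l2.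
by rewrite !scalerA.
Qed.
End CoquasiBialgebra.

(** * The left action of R on R ⊗ V *)

Section LeftAction.
Context (k : fieldType) (R : assocAlgebra k) (V : lmodType k).

(** The free left R-module structure of R ⊗ V. It is a map on the tensor product
    R ⊗ (R ⊗ V), so that its linearity in each argument is an instance. *)
Definition lact (z : (R ⊗ (R ⊗ V))%type) : (R ⊗ V)%type :=
  \ts_(r, x <- z) \ts_(s, v <- x) ((r ∗ s) ⊗ v).

Lemma lact_linear : linear lact.
Proof. by rewrite /lact; lin. Qed.
HB.instance Definition _ := GRing.isLinear.Build k
  (R ⊗ (R ⊗ V))%type (R ⊗ V)%type *:%R lact lact_linear.

Lemma lactE r s v : lact (r ⊗ (s ⊗ v)) = (r ∗ s) ⊗ v.
Proof. by rewrite /lact !tsum_tens //; lin. Qed.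

Lemma lactA r s x : lact (r ⊗ lact (s ⊗ x)) = lact ((r ∗ s) ⊗ x).
Proof.
move: x; apply: tens_ext; [by lin|by lin|] => t v.
by rewrite !lactE alg_mulA.
Qed.

End LeftAction.

Notation "r ▷ x" := (lact (r ⊗ x)) (at level 40, left associativity) : ring_scope.

(** * Products with the elements u_h = 1 # h *)

Section Crossed.
Context (k : fieldType) (H : coquasiBialgebra k) (R : assocAlgebra k).
Context (act : {linear (H ⊗ R)%type -> R}) (act_weak : weak_action act).
Context (sigma : {linear (H ⊗ H)%type -> R}).

Local Notation ε := (counit H).
Local Notation ω := (cqb_omega H).
Local Notation mul := (crossed_mul act sigma).
Local Notation u h := (alg_one R ⊗ h).
Local Notation "1H" := (cqb_one H).

(** The map I ⊗ ε. *)
Definition proj (x : (R ⊗ H)%type) : R := \ts_(r, h <- x) (ε h *: r).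

Lemma proj_linear : linear proj.
Proof. by rewrite /proj; lin. Qed.
HB.instance Definition _ := GRing.isLinear.Build k
  (R ⊗ H)%type R *:%R proj proj_linear.

Lemma projE r h : proj (r ⊗ h) = ε h *: r.
Proof. by rewrite /proj tsum_tens //; lin. Qed.

Lemma proj_lact r x : proj (r ▷ x) = r ∗ proj x.
Proof.
move: x; apply: tens_ext; [by lin|by lin|] => s v.
by rewrite lactE !projE (linear_funZ _ _ (tens_linearr _)) linearZ.
Qed.

Lemma mul_lact r x y : mul (r ▷ x ⊗ y) = r ▷ mul (x ⊗ y).
Proof.
move: x; apply: tens_ext; [by lin|by lin|] => s h.
move: y; apply: tens_ext; [by lin|by lin|] => t g.
rewrite lactE !crossed_mulE /sweedler3 -!/(sweedler2 _ _).
rewrite tens_swr linear_sw /=; apply: eq_sw => h1 h'.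
rewrite tens_swr linear_sw /=; apply: eq_sw => h2 h3.
rewrite tens_swr linear_sw /=; apply: eq_sw => g1 g2.
by rewrite lactE !alg_mulA.
Qed.

(** As h · 1 = ε(h) 1, the action disappears from the product of u_h and u_g. *)
Lemma mul_uu h g :
  mul (u h ⊗ u g) = \sw_(h1, h2 <- h) \sw_(g1, g2 <- g) (sigma (h1 ⊗ g1) ⊗ (h2 • g2)).
Proof.
rewrite crossed_mulE /sweedler3 -!/(sweedler2 _ _).
pose F h := \sw_(h1, h2 <- h) \sw_(g1, g2 <- g) (sigma (h1 ⊗ g1) ⊗ (h2 • g2)).
have lF : linear F by rewrite /F; lin.
rewrite -[RHS](sw_counitl h lF); apply: eq_sw => h1 h'.
rewrite scale_sw; apply: eq_sw => h2 h3.
rewrite scale_sw; apply: eq_sw => g1 g2.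
rewrite (weak_act_one act_weak) alg_mul1l.
rewrite !(linear_funZ _ _ (tens_linearl _)) linearZ.
by rewrite !(linear_funZ _ _ (tens_linearl _)) alg_mul1l.
Qed.

Lemma mul_u h s g :
  mul (u h ⊗ (s ⊗ g)) = \sw_(h1, h2 <- h) (act (h1 ⊗ s) ▷ mul (u h2 ⊗ u g)).
Proof.
rewrite crossed_mulE /sweedler3 -!/(sweedler2 _ _).
apply: eq_sw => h1 h'; rewrite mul_uu.
rewrite tens_swr linear_sw /=; apply: eq_sw => h2 h3.
rewrite tens_swr linear_sw /=; apply: eq_sw => g1 g2.
by rewrite lactE alg_mul1l.
Qed.

(** The rule h · (t s) = (h_1 · t) (h_2 · s) says that moving t and then s past
    u_h amounts to moving the product t s. *)
Lemma mul_u_lact h t x :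
  mul (u h ⊗ (t ▷ x)) = \sw_(h1, h2 <- h) (act (h1 ⊗ t) ▷ mul (u h2 ⊗ x)).
Proof.
move: x; apply: tens_ext; [by lin|by lin|] => s g.
rewrite lactE mul_u.
transitivity (\sw_(h1, h2 <- h) \sw_(a, b <- h1)
   (act (a ⊗ t) ▷ (act (b ⊗ s) ▷ mul (u h2 ⊗ u g)))).
  apply: eq_sw => h1 h2; rewrite (weak_act_mul act_weak) tens_swl linear_sw /=.
  by apply: eq_sw => a b; rewrite lactA.
rewrite sw_coassoc; try by lin.
by apply: eq_sw => h1 h2; rewrite mul_u tens_swr linear_sw.
Qed.

(** This is how σ is recovered from the product. *)
Lemma proj_mul_uu h g : proj (mul (u h ⊗ u g)) = sigma (h ⊗ g).
Proof.
rewrite mul_uu.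
have lF : linear (fun h => sigma (h ⊗ g)) by lin.
rewrite -[RHS](sw_counitr h lF) linear_sw; apply: eq_sw => h1 h2.
have {}lF : linear (fun g => sigma (h1 ⊗ g)) by lin.
rewrite -(sw_counitr g lF) linear_sw scale_sw; apply: eq_sw => g1 g2 /=.
by rewrite projE counit_mul scalerA.
Qed.

Lemma proj_mul_u h t g :
  proj (mul (u h ⊗ (t ⊗ g))) =
  \sw_(h1, h2 <- h) (act (h1 ⊗ t) ∗ sigma (h2 ⊗ g)).
Proof.
rewrite mul_u linear_sw; apply: eq_sw => h1 h2 /=.
by rewrite proj_lact proj_mul_uu.
Qed.

Lemma mul_tens r h y : mul ((r ⊗ h) ⊗ y) = r ▷ mul (u h ⊗ y).
Proof. by rewrite -mul_lact lactE alg_mul1r. Qed.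

Lemma mul_uu_x h g x :
  mul (mul (u h ⊗ u g) ⊗ x) =
  \sw_(h1, h2 <- h) \sw_(g1, g2 <- g) (sigma (h1 ⊗ g1) ▷ mul (u (h2 • g2) ⊗ x)).
Proof.
rewrite mul_uu.
do 2 (rewrite tens_swl linear_sw; apply: eq_sw => ? ? /=).
by rewrite mul_tens.
Qed.

(** The coefficient is the right-hand side of the twisted module condition. *)
Lemma mul_uu_t h g t l :
  mul (mul (u h ⊗ u g) ⊗ (t ⊗ l)) =
  \sw_(h1, h2 <- h) \sw_(g1, g2 <- g)
    ((\sw_(a, b <- h1) \sw_(c, d <- g1)
       (sigma (a ⊗ c) ∗ act ((b • d) ⊗ t))) ▷ mul (u (h2 • g2) ⊗ u l)).
Proof.
rewrite mul_uu_x.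
transitivity (\sw_(h1, h2 <- h) \sw_(g1, g2 <- g)
    \sw_(a, b <- h2) \sw_(c, d <- g2)
      (sigma (h1 ⊗ g1) ▷ (act ((a • c) ⊗ t) ▷ mul (u (b • d) ⊗ u l)))).
  do 2 apply: eq_sw => ? ?.
  rewrite mul_u sw_mul; try by lin.
  by do 2 (rewrite tens_swr linear_sw; apply: eq_sw => ? ? /=).
rewrite -sw_coassoc2; try by lin.
do 2 apply: eq_sw => ? ?.
do 2 (rewrite tens_swl linear_sw; apply: eq_sw => ? ? /=).
by rewrite lactA.
Qed.

Lemma mul_u_ut h g t l :
  mul (u h ⊗ mul (u g ⊗ (t ⊗ l))) =
  \sw_(h1, h2 <- h) \sw_(g1, g2 <- g)
    (act (h1 ⊗ act (g1 ⊗ t)) ▷ mul (u h2 ⊗ mul (u g2 ⊗ u l))).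
Proof.
rewrite mul_u tens_swr linear_sw sw_exchange.
by apply: eq_sw => g1 g2 /=; rewrite mul_u_lact.
Qed.

Lemma mul_rs_x r h s g y :
  mul (mul ((r ⊗ h) ⊗ (s ⊗ g)) ⊗ y) =
  r ▷ \sw_(h1, h2 <- h) (act (h1 ⊗ s) ▷ mul (mul (u h2 ⊗ u g) ⊗ y)).
Proof.
rewrite mul_tens mul_lact mul_u tens_swl linear_sw.
by congr (_ ▷ _); apply: eq_sw => h1 h2 /=; rewrite mul_lact.
Qed.

Lemma mul_r_sx r h s g y :
  mul ((r ⊗ h) ⊗ mul ((s ⊗ g) ⊗ y)) =
  r ▷ \sw_(h1, h2 <- h) (act (h1 ⊗ s) ▷ mul (u h2 ⊗ mul (u g ⊗ y))).
Proof. by rewrite (mul_tens r); congr (_ ▷ _); rewrite (mul_tens s) mul_u_lact. Qed.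

(** * The coaction *)

Lemma coactE r h : crossed_coact H R (r ⊗ h) = \sw_(h1, h2 <- h) (r ⊗ h1 ⊗ h2).
Proof. by rewrite /crossed_coact tsum_tens //; lin. Qed.

Lemma tsum_coact (W : lmodType k) r h (F : (R ⊗ H)%type -> H -> W) :
  (forall v, linear (F^~ v)) -> (forall x, linear (F x)) ->
  \ts_(x0, x1 <- crossed_coact H R (r ⊗ h)) F x0 x1 =
  \sw_(h1, h2 <- h) F (r ⊗ h1) h2.
Proof.
move=> Fl Fr; rewrite coactE.
have lF : linear (fun t : (R ⊗ H ⊗ H)%type => tsum t F) by lin.
by rewrite (fun_sw _ _ lF); apply: eq_sw => h1 h2; rewrite tsum_tens.
Qed.

(** The coaction is a comultiplication on the second factor, so both axioms are
    those of the coalgebra H. *)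
Lemma crossed_comodule : right_comodule (crossed_coact H R).
Proof.
split.
  apply: tens_ext; [by lin|by lin|] => r h.
  rewrite !tsum_coact; try by lin.
  transitivity (\sw_(h1, h2 <- h) \sw_(a, b <- h1) (r ⊗ a ⊗ b ⊗ h2)).
    by apply: eq_sw => h1 h2; rewrite tsum_coact //; lin.
  by rewrite sw_coassoc //; lin.
apply: tens_ext => [|//|r h]; first by lin.
rewrite tsum_coact; try by lin.
exact: (sw_counitr h (tens_linearr r)).
Qed.

(** The last tensor factor of the product is h_3 g_2, the product of the final
    Sweedler components, so colinearity follows from coassociativity and the
    multiplicativity of the comultiplication. *)
Lemma crossed_coact_mul x y :
  crossed_coact H R (mul (x ⊗ y)) =
  \ts_(x0, x1 <- crossed_coact H R x) \ts_(y0, y1 <- crossed_coact H R y)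
     (mul (x0 ⊗ y0) ⊗ (x1 • y1)).
Proof.
move: x; apply: tens_ext; [by lin|by lin|] => r h.
move: y; apply: tens_ext; [by lin|by lin|] => s g.
rewrite tsum_coact; try by lin.
under [RHS]eq_sw => h1 h2 do (rewrite tsum_coact; try by lin).
rewrite crossed_mulE /sweedler3 -!/(sweedler2 _ _).
pose B h1 h2 g1 := r ∗ act (h1 ⊗ s) ∗ sigma (h2 ⊗ g1).
transitivity (\sw_(h1, h' <- h) \sw_(h2, h3 <- h') \sw_(g1, g' <- g)
  \sw_(a, b <- h3) \sw_(c, d <- g') (B h1 h2 g1 ⊗ (a • c) ⊗ (b • d))).
  rewrite linear_sw; apply: eq_sw => h1 h'.
  rewrite linear_sw; apply: eq_sw => h2 h3.
  rewrite linear_sw; apply: eq_sw => g1 g' /=.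
  by rewrite coactE sw_mul //; lin.
transitivity (\sw_(h1, h2 <- h) \sw_(a, a' <- h1) \sw_(g1, g2 <- g)
  \sw_(b, c <- a') \sw_(d, e <- g1) (B a b d ⊗ (c • e) ⊗ (h2 • g2))).
  rewrite sw_coassoc; try by rewrite /B; lin.
  apply: eq_sw => h1 h'; rewrite sw_coassoc2 //; rewrite /B; lin.
apply: eq_sw => h1 h2; rewrite sw_exchange; apply: eq_sw => g1 g2.
rewrite crossed_mulE /sweedler3 -!/(sweedler2 _ _).
rewrite tens_swl; apply: eq_sw => a a'.
rewrite tens_swl; apply: eq_sw => b c.
by rewrite tens_swl.
Qed.

(** * Reduction of associativity to the elements u_h *)

Definition mul_right t h g l := mul (u h ⊗ mul (u g ⊗ (t ⊗ l))).

(** The factor h_1 · (g_1 · t) only involves the leading components of h and g,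
    while ω takes the trailing ones, so the two do not interact. *)
Lemma twist_u_ut t h g l :
  twist ω (mul_right t) h g l =
  \sw_(h1, h2 <- h) \sw_(g1, g2 <- g)
    (act (h1 ⊗ act (g1 ⊗ t)) ▷ twist ω (mul_right (alg_one R)) h2 g2 l).
Proof.
transitivity (\sw_(h1, h2 <- h) \sw_(g1, g2 <- g)
   \sw_(a, b <- h1) \sw_(c, d <- g1) \sw_(l1, l2 <- l)
    (ω (h2 ⊗ g2 ⊗ l2) *: (act (a ⊗ act (c ⊗ t)) ▷ mul_right (alg_one R) b d l1))).
  do 2 apply: eq_sw => ? ?.
  under [RHS]eq_sw => a b do rewrite sw_exchange.
  rewrite sw_exchange; apply: eq_sw => l1 l2.
  by rewrite /mul_right mul_u_ut; do 2 (rewrite scale_sw; apply: eq_sw => ? ?).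
rewrite sw_coassoc2; try by rewrite /mul_right; lin.
do 2 apply: eq_sw => ? ?.
do 3 (rewrite tens_swr linear_sw; apply: eq_sw => ? ? /=).
by rewrite (linear_funZ _ _ (tens_linearr _)) linearZ.
Qed.

(** The same separation of leading and trailing components as in [twist_u_ut],
    for the factor h_1 · s. *)
Lemma twist_r_sx r s t h g l :
  twist ω (fun h g l => mul ((r ⊗ h) ⊗ mul ((s ⊗ g) ⊗ (t ⊗ l)))) h g l =
  r ▷ \sw_(h1, h2 <- h) (act (h1 ⊗ s) ▷ twist ω (mul_right t) h2 g l).
Proof.
transitivity (\sw_(h1, h2 <- h) \sw_(a, b <- h1)
   \sw_(g1, g2 <- g) \sw_(l1, l2 <- l)
    (ω (h2 ⊗ g2 ⊗ l2) *: (r ▷ (act (a ⊗ s) ▷ mul_right t b g1 l1)))).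
  apply: eq_sw => h1 h2; rewrite [RHS]sw_exchange; apply: eq_sw => g1 g2.
  rewrite [RHS]sw_exchange; apply: eq_sw => l1 l2.
  by rewrite mul_r_sx tens_swr linear_sw scale_sw; apply: eq_sw => ? ?.
rewrite sw_coassoc; try by rewrite /mul_right; lin.
rewrite tens_swr linear_sw; apply: eq_sw => h1 h2 /=.
do 3 (rewrite tens_swr linear_sw /= tens_swr linear_sw; apply: eq_sw => ? ? /=).
by rewrite !(linear_funZ _ _ (tens_linearr _), linearZ).
Qed.

(** * The cocycle condition *)

(** The coefficients of u_h (u_g u_l) and of (u_h u_g) u_l, see [u_uuE] and
    [uu_uE]. *)
Definition coef_right h g l := \sw_(h1, h2 <- h) \sw_(g1, g2 <- g) \sw_(l1, l2 <- l)
  (act (h1 ⊗ sigma (g1 ⊗ l1)) ∗ sigma (h2 ⊗ (g2 • l2))).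
Definition coef_left h g l := \sw_(h1, h2 <- h) \sw_(g1, g2 <- g)
  (sigma (h1 ⊗ g1) ∗ sigma ((h2 • g2) ⊗ l)).

Lemma proj_u_uu h g l : proj (mul_right (alg_one R) h g l) = coef_right h g l.
Proof.
rewrite /mul_right mul_uu.
transitivity (\sw_(g1, g2 <- g) \sw_(h1, h2 <- h) \sw_(l1, l2 <- l)
   (act (h1 ⊗ sigma (g1 ⊗ l1)) ∗ sigma (h2 ⊗ (g2 • l2)))); last exact: sw_exchange.
rewrite tens_swr !linear_sw; apply: eq_sw => g1 g2 /=.
rewrite sw_exchange.
rewrite tens_swr !linear_sw; apply: eq_sw => l1 l2 /=.
by rewrite proj_mul_u.
Qed.

Lemma proj_uu_u h g l : proj (mul (mul (u h ⊗ u g) ⊗ u l)) = coef_left h g l.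
Proof.
rewrite mul_uu_x; do 2 (rewrite linear_sw; apply: eq_sw => ? ? /=).
by rewrite proj_lact proj_mul_uu.
Qed.

Lemma proj_twist phi (F : H -> H -> H -> (R ⊗ H)%type) h g l :
  proj (twist phi F h g l) = twist phi (fun h g l => proj (F h g l) : R) h g l.
Proof.
do 3 (rewrite linear_sw; apply: eq_sw => ? ? /=).
by rewrite linearZ.
Qed.

Lemma uu_uE h g l :
  mul (mul (u h ⊗ u g) ⊗ u l) =
  \sw_(h1, h2 <- h) \sw_(g1, g2 <- g) \sw_(l1, l2 <- l)
    (coef_left h1 g1 l1 ⊗ ((h2 • g2) • l2)).
Proof.
rewrite mul_uu_x.
transitivity (\sw_(h1, h2 <- h) \sw_(g1, g2 <- g)
  \sw_(a, b <- h2) \sw_(c, d <- g2) \sw_(l1, l2 <- l)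
    ((sigma (h1 ⊗ g1) ∗ sigma ((a • c) ⊗ l1)) ⊗ ((b • d) • l2))).
  do 2 apply: eq_sw => ? ?.
  rewrite mul_uu sw_mul; try by lin.
  do 3 (rewrite tens_swr linear_sw; apply: eq_sw => ? ? /=).
  by rewrite lactE.
rewrite -sw_coassoc2; try by lin.
do 2 apply: eq_sw => ? ?.
under eq_sw => a b do rewrite sw_exchange.
rewrite sw_exchange; apply: eq_sw => l1 l2.
by do 2 (rewrite tens_swl; apply: eq_sw => ? ?).
Qed.

Lemma u_uuE h g l :
  mul_right (alg_one R) h g l =
  \sw_(h1, h2 <- h) \sw_(g1, g2 <- g) \sw_(l1, l2 <- l)
    (coef_right h1 g1 l1 ⊗ (h2 • (g2 • l2))).
Proof.
rewrite /mul_right mul_uu.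
transitivity (\sw_(h1, h2 <- h) \sw_(g1, g2 <- g) \sw_(l1, l2 <- l)
  \sw_(a, b <- h2) \sw_(c, d <- g2) \sw_(e, f <- l2)
   ((act (h1 ⊗ sigma (g1 ⊗ l1)) ∗ sigma (a ⊗ (c • e))) ⊗ (b • (d • f)))).
  rewrite [RHS]sw_exchange tens_swr linear_sw; apply: eq_sw => g1 g2 /=.
  rewrite [RHS]sw_exchange tens_swr linear_sw; apply: eq_sw => l1 l2 /=.
  rewrite mul_u; apply: eq_sw => h1 h2.
  rewrite mul_uu tens_swr linear_sw; apply: eq_sw => a b /=.
  rewrite sw_mul; try by lin.
  do 2 (rewrite tens_swr linear_sw; apply: eq_sw => ? ? /=).
  by rewrite lactE.
rewrite -sw_coassoc3; try by lin.
do 3 apply: eq_sw => ? ?.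
by do 3 (rewrite tens_swl; apply: eq_sw => ? ?).
Qed.

(** The associativity of H up to ω turns the basis element h_2 (g_2 l_2) into
    (h_2 g_2) l_2 and moves ω from the trailing to the middle components, where
    it multiplies the coefficient. *)
Lemma twist_u_uuE h g l :
  twist ω (mul_right (alg_one R)) h g l =
  \sw_(h1, h2 <- h) \sw_(g1, g2 <- g) \sw_(l1, l2 <- l)
    (twist ω coef_right h1 g1 l1 ⊗ ((h2 • g2) • l2)).
Proof.
transitivity (\sw_(h1, h2 <- h) \sw_(g1, g2 <- g) \sw_(l1, l2 <- l)
  \sw_(a, b <- h2) \sw_(c, d <- g2) \sw_(e, f <- l2)
    (coef_right h1 g1 l1 ⊗ (ω (b ⊗ d ⊗ f) *: (a • (c • e))))).
  rewrite -sw_coassoc3; try by rewrite /coef_right; lin.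
  do 3 apply: eq_sw => ? ?.
  rewrite u_uuE; do 3 (rewrite scale_sw; apply: eq_sw => ? ?).
  by rewrite (linear_funZ _ _ (tens_linearr _)).
transitivity (\sw_(h1, h2 <- h) \sw_(g1, g2 <- g) \sw_(l1, l2 <- l)
  \sw_(a, b <- h2) \sw_(c, d <- g2) \sw_(e, f <- l2)
    (coef_right h1 g1 l1 ⊗ (ω (a ⊗ c ⊗ e) *: ((b • d) • f)))).
  do 3 apply: eq_sw => ? ?.
  have pull (F : H -> H -> H -> H -> H -> H -> H) (x : R) c d e :
      x ⊗ (\sw_(c1, c2 <- c) \sw_(d1, d2 <- d) \sw_(e1, e2 <- e)
             F c1 c2 d1 d2 e1 e2) =
      \sw_(c1, c2 <- c) \sw_(d1, d2 <- d) \sw_(e1, e2 <- e)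
        (x ⊗ F c1 c2 d1 d2 e1 e2).
    by do 3 (rewrite tens_swr; apply: eq_sw => ? ?).
  by rewrite -!pull cqb_mulA.
rewrite -sw_coassoc3; try by rewrite /coef_right; lin.
do 3 apply: eq_sw => ? ?.
do 3 (rewrite tens_swl; apply: eq_sw => ? ?).
by rewrite (linear_funZ _ _ (tens_linearr _)) (linear_funZ _ _ (tens_linearl _)).
Qed.

Lemma twist_coef_leftE phi h g l :
  twist phi coef_left h g l =
  \sw_(h1, h2, h3 <- h) \sw_(g1, g2, g3 <- g) \sw_(l1, l2 <- l)
     (phi (h3 ⊗ g3 ⊗ l2) *: (sigma (h1 ⊗ g1) ∗ sigma ((h2 • g2) ⊗ l1))).
Proof.
transitivity (\sw_(h1, h2 <- h) \sw_(g1, g2 <- g)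
  \sw_(a, b <- h1) \sw_(c, d <- g1) \sw_(l1, l2 <- l)
  (phi (h2 ⊗ g2 ⊗ l2) *: (sigma (a ⊗ c) ∗ sigma ((b • d) ⊗ l1)))).
  do 2 apply: eq_sw => ? ?.
  under [RHS]eq_sw => a b do rewrite sw_exchange.
  rewrite [RHS]sw_exchange; apply: eq_sw => l1 l2.
  by do 2 (rewrite scale_sw; apply: eq_sw => ? ?).
rewrite sw_coassoc2; try by lin.
by apply: eq_sw => ? ?; rewrite sw_exchange.
Qed.

(** The cocycle condition, solved for σ(h_1, g_1) σ(h_2 g_2, l) by convolution
    with ω instead of its inverse. *)
Lemma cocycleP :
  (forall h g l, coef_right h g l = twist (cqb_omegaV H) coef_left h g l) <->
  (forall h g l, twist ω coef_right h g l = coef_left h g l).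
Proof.
split=> E h g l.
  rewrite (eq_twist _ _ _ _ E) twistK //; try by lin.
  exact: omegaVK.
rewrite -(eq_twist _ _ _ _ E) twistK //; try by lin.
exact: omegaK.
Qed.

(** * The axioms of a comodule algebra *)

Lemma crossed_mul1l :
  (forall r, act (1H ⊗ r) = r) ->
  (forall h, sigma (1H ⊗ h) = ε h *: alg_one R) ->
  forall x, mul (u 1H ⊗ x) = x.
Proof.
move=> act1 sigma1l; apply: tens_ext => [|//|r h]; first by lin.
rewrite mul_u sw_one; try by lin.
rewrite act1 mul_uu sw_one; try by lin.
transitivity (r ▷ \sw_(h1, h2 <- h) (ε h1 *: u h2)).
  congr (_ ▷ _); apply: eq_sw => h1 h2.
  by rewrite sigma1l cqb_mul1l (linear_funZ _ _ (tens_linearl _)).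
by rewrite (sw_counitl h (tens_linearr (alg_one R))) lactE alg_mul1r.
Qed.

Lemma crossed_mul1r :
  (forall h, sigma (h ⊗ 1H) = ε h *: alg_one R) ->
  forall x, mul (x ⊗ u 1H) = x.
Proof.
move=> sigma1r; apply: tens_ext => [|//|r h]; first by lin.
rewrite (mul_tens r) mul_uu.
transitivity (r ▷ \sw_(h1, h2 <- h) (ε h1 *: u h2)).
  congr (_ ▷ _); apply: eq_sw => h1 h2.
  rewrite sw_one; try by lin.
  by rewrite sigma1r cqb_mul1r (linear_funZ _ _ (tens_linearl _)).
by rewrite (sw_counitl h (tens_linearr (alg_one R))) lactE alg_mul1r.
Qed.

Lemma assoc_uuu :
  (forall h g l, twist ω coef_right h g l = coef_left h g l) ->
  forall h g l, mul (mul (u h ⊗ u g) ⊗ u l) = twist ω (mul_right (alg_one R)) h g l.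
Proof.
move=> XY h g l; rewrite uu_uE twist_u_uuE.
by do 3 apply: eq_sw => ? ?; rewrite XY.
Qed.

Definition twisted_module :=
  forall h g r,
    \sw_(h1, h2 <- h) \sw_(g1, g2 <- g)
      (act (h1 ⊗ act (g1 ⊗ r)) ∗ sigma (h2 ⊗ g2)) =
    \sw_(h1, h2 <- h) \sw_(g1, g2 <- g)
      (sigma (h1 ⊗ g1) ∗ act ((h2 • g2) ⊗ r)).

(** The condition replaces the coefficient σ(h_1, g_1) ((h_2 g_2) · t) of
    [mul_uu_t] by (h_1 · (g_1 · t)) σ(h_2, g_2), and the σ is absorbed again by
    the product u_h u_g. *)
Lemma twisted_module_mul :
  twisted_module -> forall h g t l,
  mul (mul (u h ⊗ u g) ⊗ (t ⊗ l)) =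
  \sw_(h1, h2 <- h) \sw_(g1, g2 <- g)
    (act (h1 ⊗ act (g1 ⊗ t)) ▷ mul (mul (u h2 ⊗ u g2) ⊗ u l)).
Proof.
move=> tm h g t l; rewrite mul_uu_t.
transitivity (\sw_(h1, h2 <- h) \sw_(g1, g2 <- g)
  \sw_(a, b <- h1) \sw_(c, d <- g1)
   (act (a ⊗ act (c ⊗ t)) ▷ (sigma (b ⊗ d) ▷ mul (u (h2 • g2) ⊗ u l)))).
  do 2 apply: eq_sw => ? ?; rewrite -tm.
  do 2 (rewrite tens_swl linear_sw; apply: eq_sw => ? ? /=).
  by rewrite lactA.
rewrite sw_coassoc2; try by lin.
do 2 apply: eq_sw => ? ?.
by rewrite mul_uu_x; do 2 (rewrite tens_swr linear_sw; apply: eq_sw => ? ? /=).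
Qed.

Lemma assoc_uut :
  twisted_module ->
  (forall h g l, mul (mul (u h ⊗ u g) ⊗ u l) = twist ω (mul_right (alg_one R)) h g l) ->
  forall h g t l, mul (mul (u h ⊗ u g) ⊗ (t ⊗ l)) = twist ω (mul_right t) h g l.
Proof.
move=> tm A h g t l; rewrite twisted_module_mul // twist_u_ut.
by do 2 apply: eq_sw => ? ?; rewrite A.
Qed.

Lemma assoc_rst :
  (forall h g t l, mul (mul (u h ⊗ u g) ⊗ (t ⊗ l)) = twist ω (mul_right t) h g l) ->
  forall r h s g t l,
  mul (mul ((r ⊗ h) ⊗ (s ⊗ g)) ⊗ (t ⊗ l)) =
  twist ω (fun h g l => mul ((r ⊗ h) ⊗ mul ((s ⊗ g) ⊗ (t ⊗ l)))) h g l.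
Proof.
move=> A r h s g t l; rewrite twist_r_sx mul_rs_x.
by congr (_ ▷ _); apply: eq_sw => h1 h2; rewrite A.
Qed.

Lemma coact_twist r h s g t l :
  \ts_(a0, a1 <- crossed_coact H R (r ⊗ h))
  \ts_(b0, b1 <- crossed_coact H R (s ⊗ g))
  \ts_(c0, c1 <- crossed_coact H R (t ⊗ l))
      (ω (a1 ⊗ b1 ⊗ c1) *: mul (a0 ⊗ mul (b0 ⊗ c0))) =
  twist ω (fun h g l => mul ((r ⊗ h) ⊗ mul ((s ⊗ g) ⊗ (t ⊗ l)))) h g l.
Proof.
rewrite tsum_coact; try by lin.
apply: eq_sw => h1 h2; rewrite tsum_coact; try by lin.
by apply: eq_sw => g1 g2; rewrite tsum_coact; try by lin.
Qed.

(** The comodule axioms, and the colinearity of product and unit, hold for all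
    σ; associativity may be tested on pure tensors. *)
Lemma crossed_algebraP :
  comodule_algebra (H := H) (crossed_coact H R) mul (u 1H) <->
  [/\ forall x, mul (u 1H ⊗ x) = x, forall x, mul (x ⊗ u 1H) = x
    & forall r h s g t l,
      mul (mul ((r ⊗ h) ⊗ (s ⊗ g)) ⊗ (t ⊗ l)) =
      twist ω (fun h g l => mul ((r ⊗ h) ⊗ mul ((s ⊗ g) ⊗ (t ⊗ l)))) h g l].
Proof.
split=> [[_ _ _ m1l m1r mA]|[m1l m1r mA]].
  by split=> // *; rewrite mA coact_twist.
split=> //.
- exact: crossed_comodule.
- exact: crossed_coact_mul.
- by rewrite [LHS]coactE sw_one //; lin.
move=> x y z.
move: x; apply: tens_ext; [by lin|by lin|] => r h.
move: y; apply: tens_ext; [by lin|by lin|] => s g.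
move: z; apply: tens_ext; [by lin|by lin|] => t l.
by rewrite [RHS]coact_twist; exact: mA.
Qed.

(** Both normalizations come from the single identity
    (1_H · s) σ(1_H, g) = ε(g) s, taken at s = 1 and then at g = 1_H. *)
Lemma mul1l_normal :
  (forall x, mul (u 1H ⊗ x) = x) ->
  (forall r, act (1H ⊗ r) = r) /\ (forall h, sigma (1H ⊗ h) = ε h *: alg_one R).
Proof.
move=> m1l.
have E s g : act (1H ⊗ s) ∗ sigma (1H ⊗ g) = ε g *: s.
  have := congr1 proj (m1l (s ⊗ g)).
  by rewrite proj_mul_u projE sw_one //; lin.
have sigma1l g : sigma (1H ⊗ g) = ε g *: alg_one R.
  by rewrite -E (weak_act_one act_weak) counit_one scale1r alg_mul1l.
split=> // r; have := E r 1H.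
by rewrite sigma1l counit_one !scale1r alg_mul1r.
Qed.

Lemma mul1r_normal :
  (forall x, mul (x ⊗ u 1H) = x) -> forall h, sigma (h ⊗ 1H) = ε h *: alg_one R.
Proof.
by move=> m1r h; rewrite -proj_mul_uu m1r projE.
Qed.

(** Associativity with t, and backwards with 1 in place of t, at l = 1_H, where
    u_l is the unit, gives
    (u_h u_g) (t # 1_H) = (h_1 · (g_1 · t)) ▷ (u_{h_2} u_{g_2}).
    The condition is the image of this identity under I ⊗ ε. *)
Lemma assoc_twisted_module :
  (forall x, mul (x ⊗ u 1H) = x) ->
  (forall h g t l, mul (mul (u h ⊗ u g) ⊗ (t ⊗ l)) = twist ω (mul_right t) h g l) ->
  twisted_module.
Proof.
move=> m1r A h g t.
have E : mul (mul (u h ⊗ u g) ⊗ (t ⊗ 1H)) =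
    \sw_(h1, h2 <- h) \sw_(g1, g2 <- g)
      (act (h1 ⊗ act (g1 ⊗ t)) ▷ mul (u h2 ⊗ u g2)).
  rewrite A twist_u_ut; do 2 apply: eq_sw => ? ?.
  by rewrite -A m1r.
transitivity (proj (mul (mul (u h ⊗ u g) ⊗ (t ⊗ 1H)))).
  rewrite E; do 2 (rewrite linear_sw; apply: eq_sw => ? ? /=).
  by rewrite proj_lact proj_mul_uu.
rewrite mul_uu_x; do 2 (rewrite linear_sw; apply: eq_sw => ? ? /=).
rewrite proj_lact proj_mul_u; congr (_ ∗ _).
have lF : linear (fun x => act (x ⊗ t)) by lin.
rewrite -(sw_counitr _ lF); apply: eq_sw => ? ?.
by rewrite (mul1r_normal m1r) (linear_funZ _ _ (tens_linearr _)) linearZ alg_mul1r.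
Qed.

End Crossed.

Theorem theorem9 (k : fieldType) (H : coquasiBialgebra k) (R : assocAlgebra k)
    (act : {linear (H ⊗ R)%type -> R}) (act_weak : weak_action act)
    (sigma : {linear (H ⊗ H)%type -> R}) :
  comodule_algebra (H := H) (crossed_coact H R) (crossed_mul act sigma)
    (alg_one R ⊗ cqb_one H) <->
  [/\ forall r : R, act (cqb_one H ⊗ r) = r,
      forall (h g : H) (r : R),
        \sw_(h1, h2 <- h) \sw_(g1, g2 <- g)
          (act (h1 ⊗ act (g1 ⊗ r)) ∗ sigma (h2 ⊗ g2)) =
        \sw_(h1, h2 <- h) \sw_(g1, g2 <- g)
          (sigma (h1 ⊗ g1) ∗ act ((h2 • g2) ⊗ r)),
      forall h : H,
        sigma (h ⊗ cqb_one H) = counit H h *: alg_one R /\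
        sigma (cqb_one H ⊗ h) = counit H h *: alg_one R
    & forall h g l : H,
        \sw_(h1, h2 <- h) \sw_(g1, g2 <- g) \sw_(l1, l2 <- l)
          (act (h1 ⊗ sigma (g1 ⊗ l1)) ∗ sigma (h2 ⊗ (g2 • l2))) =
        \sw_(h1, h2, h3 <- h) \sw_(g1, g2, g3 <- g) \sw_(l1, l2 <- l)
          (cqb_omegaV H (h3 ⊗ g3 ⊗ l2) *:
             (sigma (h1 ⊗ g1) ∗ sigma ((h2 • g2) ⊗ l1)))].
Proof.
split=> [/(crossed_algebraP act sigma)[m1l m1r mA]|[act1 tm sigma1 XYV]].
  have [act1 sigma1l] := mul1l_normal act_weak m1l.
  have A h g t l : crossed_mul act sigma (crossed_mul act sigma
      ((alg_one R ⊗ h) ⊗ (alg_one R ⊗ g)) ⊗ (t ⊗ l)) = _ := mA _ h _ g t l.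
  have sigma1r := mul1r_normal act_weak m1r.
  split=> // [|h g l]; first exact: (assoc_twisted_module act_weak m1r).
  rewrite -twist_coef_leftE; move: h g l; apply/cocycleP => h g l.
  rewrite -(proj_uu_u act_weak) A proj_twist.
  by apply: eq_twist => *; rewrite (proj_u_uu act_weak).
apply/(crossed_algebraP act sigma); split.
- by apply: (crossed_mul1l act_weak) => // h; case: (sigma1 h).
- by apply: (crossed_mul1r act_weak) => h; case: (sigma1 h).
apply: (assoc_rst act_weak); apply: (assoc_uut act_weak) => //.
apply: (assoc_uuu act_weak); apply/cocycleP => h g l.
by rewrite twist_coef_leftE; exact: XYV.
Qed.
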